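(* Let $(\eta, Q)$ be an $n$-dimensional nilsoliton metric Lie algebra with Ricci eigenvector basis $B$, let $Y$ be its root matrix with respect to $B$, and let $U = YY^T$ be the corresponding $m\times m$ Gram matrix. Suppose that $U$ is noninvertible. Then $\operatorname{Ker}(Y^T) = \operatorname{Ker}(U)$. Furthermore, all solutions $v\in\mathbb{R}^m$ of $Uv=[1]$ correspond to a unique derivation; that is, if $v, w \in \mathbb{R}^m$ satisfy $Uv=[1]$ and $Uw=[1]$, then $D_v = D_w$.
   Context: A metric Lie algebra $(\eta,Q)$ is a real finite-dimensional (here nilpotent) Lie algebra with an inner product $Q=\langle\cdot,\cdot\rangle$. For a $Q$-orthonormal basis $X_1,\dots,X_n$, the nil-Ricci endomorphism $\mathrm{Ric}$ is defined by $\langle \mathrm{Ric}\,X, Z\rangle = -\frac12\sum_{i}\langle [X,X_i],[Z,X_i]\rangle + \frac14\sum_{i,j}\langle [X_i,X_j],X\rangle\langle [X_i,X_j],Z\rangle$. For a nilpotent Lie algebra this is the Ricci endomorphism. A Ricci eigenvector basis is an ordered orthonormal basis $B=\{X_i\}_{i=1}^n$ all of whose elements are eigenvectors of $\mathrm{Ric}$. The metric Lie algebra is nilsoliton, with nilsoliton constant $\beta\in\mathbb{R}$, if $\mathrm{Ric}-\beta\,\mathrm{Id}$ is a derivation of $\eta$. Let $\alpha_{ij}^k$ be the structure constants relative to $B$, so $[X_i,X_j]=\sum_k\alpha_{ij}^kX_k$, and let $\Lambda$ be the set of triples $(i,j,k)$ with $i<j$ and $\alpha_{ij}^k\neq 0$;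 put $m=|\Lambda|$. For $(i,j,k)\in\Lambda$ the root vector is the row vector $y_{ij}^k=\epsilon_i^T+\epsilon_j^T-\epsilon_k^T$, where $\epsilon_1,\dots,\epsilon_n$ is the standard basis of $\mathbb{R}^n$. The root matrix $Y$ is the $m\times n$ matrix whose rows are the root vectors in dictionary order of $\Lambda$, and the Gram matrix is $U=YY^T$. $[1]$ denotes the $m\times 1$ column vector of ones. A solution $v$ of $Uv=[1]$ corresponds to a derivation $D_v$ as follows: let $\mathrm{Ric}_v=-\frac12Y^Tv\in\mathbb{R}^n$, let $\beta_v$ be the common value of $y_{ij}^k\,\mathrm{Ric}_v$ over all $(i,j,k)\in\Lambda$ (the entries of $Y\mathrm{Ric}_v=-\frac12Uv$ are all equal), and let $D_v$ be the endomorphism of $\eta$ that is diagonal in the basis $B$ with eigenvalue vector $\mathrm{Ric}_v-\beta_v(1,\dots,1)^T$. *)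

(* Defs.v *)
From HB Require Import structures.
From mathcomp Require Import all_boot all_order all_algebra.
From mathcomp Require Import boolp classical_sets reals.

Set Implicit Arguments.
Unset Strict Implicit.
Unset Printing Implicit Defensive.

Import Order.TTheory GRing.Theory Num.Theory.
Local Open Scope ring_scope.

Section LieAlgebra.
Variables (R : realType) (V : vectType R) (br : {bilinear V -> V -> V}).

Definition lie_bracket : Prop :=
  (forall x, br x x = 0) /\
  (forall x y z, br x (br y z) + br y (br z x) + br z (br x y) = 0).

Definition commv (U W : {vspace V}) : {vspace V} :=
  <<[seq br u w | u <- vbasis U, w <- vbasis W]>>%VS.

Lemma commvP (U W S : {vspace V}) :
  reflect (forall u w, u \in U -> w \in W -> br u w \in S)
          (commv U W <= S)%VS.
Proof.
apply: (iffP idP) => [/span_subvP sS u w uU wW|sS].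
  rewrite (coord_vbasis uU) (coord_vbasis wW) linear_sumlz.
  apply: memv_suml => i _; rewrite linear_sumr; apply: memv_suml => j _.
  rewrite linearZl_LR linearZr_LR !rpredZ// sS//.
  by apply: allpairs_f; apply: mem_nth; rewrite size_tuple ltn_ord.
apply/span_subvP => _ /allpairsP[[u w] /= [uU wW ->]].
by apply: sS; apply: vbasis_mem.
Qed.

Fixpoint lower_central_series (k : nat) : {vspace V} :=
  if k is k'.+1 then commv fullv (lower_central_series k') else fullv.

Definition nilpotent : Prop := exists k, lower_central_series k = 0%VS.

Definition is_derivation (D : 'End(V)) : Prop :=
  forall x y, D (br x y) = br (D x) y + br x (D y).

End LieAlgebra.

Section MetricLieAlgebra.
Variables (R : realType) (V : vectType R).
Variables (br : {bilinear V -> V -> V}) (Q : {dot V for idfun}).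

Definition orthonormal_basis n (X : n.-tuple V) : bool :=
  basis_of fullv X && orthonormal Q X.

Lemma dotC x y : Q x y = Q y x.
Proof. by rewrite hermitian_subproof expr0 mul1r. Qed.

Lemma dotDl x y z : Q (x + y) z = Q x z + Q y z.
Proof. exact: linearDl. Qed.

Lemma dotZl a x z : Q (a *: x) z = a * Q x z.
Proof. exact: linearZl_LR. Qed.

Lemma dot_suml n (F : 'I_n -> V) z : Q (\sum_i F i) z = \sum_i Q (F i) z.
Proof. exact: linear_sumlz. Qed.

Lemma dotDr x y z : Q x (y + z) = Q x y + Q x z.
Proof. by rewrite !(dotC x) dotDl. Qed.

Lemma dotZr a x z : Q x (a *: z) = a * Q x z.
Proof. by rewrite !(dotC x) dotZl. Qed.

Lemma dot_sumr n (F : 'I_n -> V) x : Q x (\sum_i F i) = \sum_i Q x (F i).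
Proof. by rewrite dotC dot_suml; apply: eq_bigr => i _; rewrite dotC. Qed.

Lemma dot_eq0 x : (forall z, Q x z = 0) -> x = 0.
Proof.
move=> Qx; apply/eqP; apply: contraT => /(neq0_dnorm_gt0 (s := Q)).
by rewrite Qx ltxx.
Qed.

Lemma orthonormal_basisE n (X : n.-tuple V) (i j : 'I_n) :
  orthonormal_basis X -> Q X`_i X`_j = (i == j)%:R.
Proof.
case/andP=> _ /andP[/allP X1 oX].
have lt_ij (s : seq V) a b : pair_ortho_rec Q s -> (a < b < size s)%N ->
    Q s`_a s`_b = 0.
  elim: s a b => [|x s IH] a [|b] //=; rewrite ?ltn0 ?andbF//.
  case/andP=> /=; rewrite /ortho_rec /= andbT => /allP xs os.
  case: a => [|a] /=; last by rewrite !ltnS => ab; apply: IH.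
  rewrite ltnS => bs; have /= := xs _ (mem_nth 0 bs).
  exact/eqP.
have [->|] := eqVneq i j.
  by apply/eqP/X1/mem_nth; rewrite size_tuple.
rewrite neq_ltn => /orP[] ij; last rewrite dotC;
  by apply: lt_ij => //; rewrite ij size_tuple ltn_ord.
Qed.

Lemma orthonormal_coord n (X : n.-tuple V) x :
  orthonormal_basis X -> x = \sum_(i < n) Q x X`_i *: X`_i.
Proof.
move=> oX; have /andP[bX _] := oX.
rewrite {1}(coord_basis bX (memvf x)); apply: eq_bigr => i _; congr (_ *: _).
rewrite {2}(coord_basis bX (memvf x)) dot_suml (bigD1 i)//= big1.
  by rewrite addr0 dotZl orthonormal_basisE// eqxx mulr1.
by move=> j ji; rewrite dotZl orthonormal_basisE// (negPf ji) mulr0.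
Qed.

Lemma parseval n (X : n.-tuple V) x y : orthonormal_basis X ->
  Q x y = \sum_(i < n) Q x X`_i * Q y X`_i.
Proof.
move=> oX; rewrite {1}(orthonormal_coord y oX) dot_sumr.
by apply: eq_bigr => i _; rewrite dotZr mulrC.
Qed.

Definition ricci_form n (X : n.-tuple V) (x z : V) : R :=
  - 2^-1 * (\sum_(i < n) Q (br x X`_i) (br z X`_i))
  + 4^-1 * (\sum_(i < n) \sum_(j < n) Q (br X`_i X`_j) x * Q (br X`_i X`_j) z).

Lemma trace_indep n m (X : n.-tuple V) (Y : m.-tuple V) (f : V -> V -> R) :
  (forall y, linear_for *%R (f^~ y)) -> (forall x, linear_for *%R (f x)) ->
  orthonormal_basis X -> orthonormal_basis Y ->
  \sum_(i < n) f X`_i X`_i = \sum_(j < m) f Y`_j Y`_j.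
Proof.
move=> fl fr oX oY.
have f0l y : f 0 y = 0.
  have e : f ((-1) *: 0 + 0) y = -1 * f 0 y + f 0 y := fl y (-1) 0 0.
  by rewrite scaler0 addr0 mulN1r addNr in e.
have f0r x : f x 0 = 0.
  have e : f x ((-1) *: 0 + 0) = -1 * f x 0 + f x 0 := fr x (-1) 0 0.
  by rewrite scaler0 addr0 mulN1r addNr in e.
have fsl y k (c : 'I_k -> R) (Z : 'I_k -> V) :
    f (\sum_i c i *: Z i) y = \sum_i c i * f (Z i) y.
  elim/big_rec2: _ => [|i a b _ <-]; first exact: f0l.
  exact: (fl y).
have fsr x k (c : 'I_k -> R) (Z : 'I_k -> V) :
    f x (\sum_i c i *: Z i) = \sum_i c i * f x (Z i).
  elim/big_rec2: _ => [|i a b _ <-]; first exact: f0r.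
  exact: (fr x).
have -> : \sum_(i < n) f X`_i X`_i =
    \sum_(i < n) \sum_(j < m) \sum_(k < m)
       (Q Y`_j X`_i * Q Y`_k X`_i) * f Y`_j Y`_k.
  apply: eq_bigr => i _.
  rewrite {1}(orthonormal_coord X`_i oY) fsl; apply: eq_bigr => j _.
  rewrite [X in f _ X](orthonormal_coord X`_i oY) fsr mulr_sumr; apply: eq_bigr => k _.
  by rewrite (dotC X`_i Y`_j) (dotC X`_i Y`_k) mulrA.
rewrite exchange_big /=; apply: eq_bigr => j _.
rewrite exchange_big /= (bigD1 j)//= [X in _ + X]big1 ?addr0 => [|k kj].
  by rewrite -mulr_suml -parseval// orthonormal_basisE// eqxx mul1r.
rewrite -mulr_suml -parseval// orthonormal_basisE// eq_sym (negPf kj).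
by rewrite mul0r.
Qed.

Lemma ricci_form_indep n m (X : n.-tuple V) (Y : m.-tuple V) x z :
  orthonormal_basis X -> orthonormal_basis Y ->
  ricci_form X x z = ricci_form Y x z.
Proof.
move=> oX oY; rewrite /ricci_form; congr (_ * _ + _ * _).
  apply: (trace_indep (f := fun a b => Q (br x a) (br z b))) => // c a u v /=.
    by rewrite linearPr dotDl dotZl.
  by rewrite linearPr dotDr dotZr.
transitivity (\sum_(i < n) \sum_(j < m) Q (br X`_i Y`_j) x * Q (br X`_i Y`_j) z).
  apply: eq_bigr => i _.
  apply: (trace_indep
    (f := fun a b => Q (br X`_i a) x * Q (br X`_i b) z)) => // c a u v /=.
    by rewrite linearPr dotDl dotZl mulrDl mulrA.
  by rewrite linearPr dotDl dotZl mulrDr mulrCA.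
rewrite exchange_big [RHS]exchange_big /=; apply: eq_bigr => j _.
apply: (trace_indep
  (f := fun a b => Q (br a Y`_j) x * Q (br b Y`_j) z)) => // c a u v /=.
  by rewrite linearPl dotDl dotZl mulrDl mulrA.
by rewrite linearPl dotDl dotZl mulrDr mulrCA.
Qed.

Definition is_nil_ricci (Rc : 'End(V)) : Prop :=
  forall n (X : n.-tuple V), orthonormal_basis X ->
  forall x z, Q (Rc x) z = ricci_form X x z.

(* The defining property pins down at most one endomorphism, and one exists as
   soon as there is an orthonormal basis: see nil_ricciP. *)
Definition nil_ricci : 'End(V) := xget 0 [set Rc | is_nil_ricci Rc]%classic.

Lemma nil_ricciP n (X : n.-tuple V) x z : orthonormal_basis X ->
  Q (nil_ricci x) z = ricci_form X x z.
Proof.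
move=> oX; suff : is_nil_ricci nil_ricci by apply.
apply: (@xgetPex _ 0 [set Rc | is_nil_ricci Rc]%classic).
pose f y := \sum_(k < n) ricci_form X y X`_k *: X`_k.
have flin : linear f.
  move=> a u v; rewrite /f scaler_sumr -big_split; apply: eq_bigr => k _ /=.
  rewrite scalerA -scalerDl; congr (_ *: _); rewrite /ricci_form.
  under eq_bigr do rewrite linearPl dotDl dotZl.
  under [X in _ + 4^-1 * X]eq_bigr do
    under eq_bigr do rewrite linearPr mulrDl -mulrA.
  rewrite big_split -mulr_sumr /=.
  under [X in _ + 4^-1 * X]eq_bigr do rewrite big_split -mulr_sumr /=.
  rewrite big_split -mulr_sumr /= !mulrDr addrACA; congr (_ + _).
  by congr (_ + _); rewrite mulrCA.
pose g := GRing.isLinear.Build _ _ _ _ f flin.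
pose L : {linear V -> V} := HB.pack f g.
exists (linfun L) => m Y oY u w.
rewrite (ricci_form_indep _ _ oY oX) (lfunE L) /= /f dot_suml.
have rl : linear_for *%R (ricci_form X u).
  move=> a b c; rewrite /ricci_form.
  under eq_bigr do rewrite linearPl dotDr dotZr.
  under [X in _ + 4^-1 * X]eq_bigr do
    under eq_bigr do rewrite linearPr mulrDr mulrCA.
  rewrite big_split -mulr_sumr /=.
  under [X in _ + 4^-1 * X]eq_bigr do rewrite big_split -mulr_sumr /=.
  rewrite big_split -mulr_sumr /= !mulrDr addrACA; congr (_ + _).
  by congr (_ + _); rewrite mulrCA.
rewrite {2}(orthonormal_coord w oX).
elim/big_rec2: _ => [|k a b _ ->].
  have e : ricci_form X u ((-1) *: 0 + 0) = _ := rl (-1) 0 0.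
  by rewrite scaler0 addr0 mulN1r addNr in e.
by rewrite rl dotZl /= (dotC w) mulrC.
Qed.

Definition is_nilsoliton : Prop :=
  exists beta : R, is_derivation br (nil_ricci - beta *: \1%VF).

Definition ricci_eigenbasis n (B : n.-tuple V) : Prop :=
  orthonormal_basis B /\
  forall i : 'I_n, exists a : R, nil_ricci B`_i = a *: B`_i.

End MetricLieAlgebra.

Section RootMatrix.
Variables (R : realType) (V : vectType R) (br : {bilinear V -> V -> V}).
Variables (n : nat) (B : n.-tuple V).

Definition structure_constant (i j k : 'I_n) : R :=
  coord B k (br B`_i B`_j).

(* ((i, j), k) stands for the triple (i, j, k). *)
Definition Lambda : {set 'I_n * 'I_n * 'I_n} :=
  [set t : 'I_n * 'I_n * 'I_n |
     (t.1.1 < t.1.2)%N & structure_constant t.1.1 t.1.2 t.2 != 0].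

Definition root_vector (t : 'I_n * 'I_n * 'I_n) : 'rV[R]_n :=
  'e_(t.1.1) + 'e_(t.1.2) - 'e_(t.2).

(* enum_val lists Lambda in dictionary order: see Lambda_dictionary. *)
Definition root_matrix : 'M[R]_(#|Lambda|, n) :=
  \matrix_(p < #|Lambda|) root_vector (enum_val p).

Definition dictionary_lt : rel ('I_n * 'I_n * 'I_n) := fun s t =>
  [|| (s.1.1 < t.1.1)%N,
      (s.1.1 == t.1.1) && (s.1.2 < t.1.2)%N |
      [&& s.1.1 == t.1.1, s.1.2 == t.1.2 & (s.2 < t.2)%N]].

Lemma Lambda_dictionary (p q : 'I_#|Lambda|) :
  (p < q)%N -> dictionary_lt (enum_val p) (enum_val q).
Proof.
have pw_prod (S T : eqType) (rS : rel S) (rT : rel T) s t :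
    pairwise rS s -> pairwise rT t ->
    pairwise (fun a b : S * T => rS a.1 b.1 || (a.1 == b.1) && rT a.2 b.2)
      [seq (x, y) | x <- s, y <- t].
  move=> + tP; elim: s => //= x s IH /andP[/allP xs /IH {}IH].
  rewrite pairwise_cat IH andbT; apply/andP; split.
    apply/allrelP => a b /mapP[y _ ->] /allpairsP[[x' y'] /= [x's _ ->]] /=.
    by rewrite xs.
  rewrite pairwise_map; apply: sub_pairwise tP => a b /= ->.
  by rewrite eqxx orbT.
have pw_ord : pairwise (fun i j : 'I_n => (i < j)%N) (enum 'I_n).
  have := iota_ltn_sorted 0 n; rewrite -val_enum_ord sorted_pairwise.
    by rewrite pairwise_map.
  exact: ltn_trans.
have pw : pairwise dictionary_lt (enum Lambda).
  rewrite /enum_mem; apply: (subseq_pairwise (filter_subseq _ _)).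
  have := pw_prod _ _ _ _ _ _ (pw_prod _ _ _ _ _ _ pw_ord pw_ord) pw_ord.
  have enum_prod (S T : finType) : Finite.enum (S * T)%type = prod_enum S T.
    by rewrite unlock.
  rewrite (enum_prod _ (ordinal n)) /prod_enum (enumT ('I_n * 'I_n)%type).
  rewrite (enum_prod (ordinal n) (ordinal n)) /prod_enum.
  apply: sub_pairwise => -[[a b] c] [[d e] f] /=.
  by rewrite /dictionary_lt /= xpair_eqE -orbA -andbA.
move=> pq; have [x0 _] : exists x0 : 'I_n * 'I_n * 'I_n, true.
  by exists (enum_val p).
rewrite (enum_val_nth x0 p) (enum_val_nth x0 q).
have /(pairwiseP x0) := pw; apply => //; by rewrite inE -cardE ltn_ord.
Qed.

Definition gram_matrix : 'M[R]_#|Lambda| := root_matrix *m root_matrix^T.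

Definition Ric_of (v : 'cV[R]_#|Lambda|) : 'cV[R]_n :=
  - 2^-1 *: (root_matrix^T *m v).

(* The entries of Y Ric_v are all equal when U v = [1] (see beta_ofE), so any
   entry can be read off; the value 0 is only used when Lambda is empty. *)
Definition beta_of (v : 'cV[R]_#|Lambda|) : R :=
  if [pick p : 'I_#|Lambda|] is Some p then (root_matrix *m Ric_of v) p 0
  else 0.

Lemma root_matrix_mulE (r : 'cV[R]_n) p (t := enum_val p) :
  (root_matrix *m r) p 0 = r t.1.1 0 + r t.1.2 0 - r t.2 0.
Proof.
have -> : (root_matrix *m r) p 0 = row p (root_matrix *m r) 0 0.
  by rewrite [RHS]mxE.
by rewrite row_mul rowK mulmxBl mulmxDl -!rowE !mxE.
Qed.

Lemma beta_ofE v : gram_matrix *m v = const_mx 1 ->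
  forall p, (root_matrix *m Ric_of v) p 0 = beta_of v.
Proof.
move=> Uv p; rewrite /beta_of; case: pickP => [q _|/(_ p)//].
by rewrite /Ric_of -scalemxAr mulmxA -/gram_matrix Uv !mxE.
Qed.

Definition diag_fun (d : 'cV[R]_n) (x : V) : V :=
  \sum_(i < n) (d i 0 * coord B i x) *: B`_i.

Fact diag_fun_linear d : linear (diag_fun d).
Proof.
move=> a x y; rewrite /diag_fun scaler_sumr -big_split.
apply: eq_bigr => i _ /=.
by rewrite linearP scalerA -scalerDl mulrDr mulrCA.
Qed.

HB.instance Definition _ d :=
  GRing.isLinear.Build R V V _ (diag_fun d) (diag_fun_linear d).

Definition diag_end (d : 'cV[R]_n) : 'End(V) := linfun (diag_fun d).

Definition D_of (v : 'cV[R]_#|Lambda|) : 'End(V) :=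
  diag_end (Ric_of v - beta_of v *: const_mx 1).

Lemma diag_end_basis d (i : 'I_n) : basis_of fullv B ->
  diag_end d B`_i = d i 0 *: B`_i.
Proof.
move=> bB; rewrite /diag_end lfunE /= /diag_fun (bigD1 i)//=.
rewrite coord_free ?(basis_free bB)//.
rewrite eqxx mulr1 big1 ?addr0// => j ji.
by rewrite coord_free ?(basis_free bB)// eq_sym (negPf ji) mulr0 scale0r.
Qed.

Lemma D_of_derivation v : basis_of fullv B -> lie_bracket br ->
  gram_matrix *m v = const_mx 1 -> is_derivation br (D_of v).
Proof.
move=> bB [brxx _] Uv.
have brC x y : br x y = - br y x.
  apply/eqP; rewrite -addr_eq0; have := brxx (x + y).
  by rewrite linearDl !linearDr !brxx add0r addr0 => ->.
set D := D_of v; pose d := Ric_of v - beta_of v *: const_mx 1.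
have DB (i : 'I_n) : D B`_i = d i 0 *: B`_i by apply: diag_end_basis.
have lt_case (i j k : 'I_n) : (i < j)%N -> structure_constant i j k != 0 ->
    d k 0 = d i 0 + d j 0.
  move=> ij a0; have tL : (i, j, k) \in Lambda by rewrite inE /= ij.
  have := beta_ofE Uv (enum_rank_in tL (i, j, k)).
  rewrite root_matrix_mulE enum_rankK_in//= => /eqP.
  rewrite subr_eq => /eqP E.
  have dE l : d l 0 = Ric_of v l 0 - beta_of v.
    by rewrite /d [LHS]mxE; congr (_ + _); rewrite !mxE mulr1.
  by rewrite !dE addrACA E [_ + Ric_of v k 0]addrC -addrA addrA addrA addrK.
have brB (i j : 'I_n) : D (br B`_i B`_j) = (d i 0 + d j 0) *: br B`_i B`_j.
  wlog ij : i j / (i < j)%N.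
    move=> W; have [|ji|/val_inj->] := ltngtP i j; first exact: W.
      by rewrite brC linearN /= W// addrC scalerN.
    by rewrite brxx linear0 scaler0.
  rewrite (coord_basis bB (memvf (br B`_i B`_j))) linear_sum scaler_sumr.
  apply: eq_bigr => k _; rewrite linearZ /= DB !scalerA.
  have [->|/(lt_case _ _ _ ij) ->] := eqVneq (coord B k (br B`_i B`_j)) 0.
    by rewrite mul0r mulr0.
  by rewrite mulrC.
have DBl (i : 'I_n) y : D (br B`_i y) = br (D B`_i) y + br B`_i (D y).
  rewrite (coord_basis bB (memvf y)).
  rewrite (linear_sum D) !linear_sumr (linear_sum D) -big_split.
  apply: eq_bigr => j _ /=.
  rewrite !(linearZr_LR, linearZ) /= brB !DB linearZl_LR linearZr_LR.
  by rewrite -scalerDr -scalerDl.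
move=> x y; rewrite (coord_basis bB (memvf x)).
rewrite (linear_sum D) !linear_sumlz (linear_sum D) -big_split.
apply: eq_bigr => i _ /=.
by rewrite !(linearZl_LR, linearZ) /= DBl scalerDr.
Qed.

End RootMatrix.

(* The kernel of A as a map on column vectors; kermx is the row kernel. *)
Definition col_ker (R : realType) m n (A : 'M[R]_(m, n)) : set 'cV[R]_n :=
  [set v | A *m v = 0]%classic.

(* Main.v *)
Require Import Defs.
From HB Require Import structures.
From mathcomp Require Import all_boot all_order all_algebra.
From mathcomp Require Import boolp classical_sets reals.

Set Implicit Arguments.
Unset Strict Implicit.
Unset Printing Implicit Defensive.

Import Order.TTheory GRing.Theory Num.Theory.
Local Open Scope ring_scope.

(** Both claims rest on one fact of linear algebra over an ordered domain: since
    [v^T U v = v^T Y Y^T v] is the sum of the squares of the entries of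
    [Y^T v], the kernel of the Gram matrix [U = Y Y^T] is exactly that of
    [Y^T] ([gram_mul_eq0]).

    If [U v = U w], then [v - w] lies in this common kernel, hence
    [Y^T v = Y^T w].  The derivation [D_v] depends on [v] only through [Y^T v]:
    the vector [Ric_v] is a multiple of [Y^T v], and [beta_v] is computed from
    [Y Ric_v].  Therefore [D_v = D_w] ([eq_gram_mul_D_of]). *)

Lemma sum_sqr_eq0 (R : realDomainType) n (u : 'cV[R]_n) :
  u^T *m u = 0 -> u = 0.
Proof.
move=> /matrixP/(_ 0 0); rewrite !mxE => /eqP.
rewrite psumr_eq0 => [/allP u0|i _]; last by rewrite mxE -expr2 sqr_ge0.
apply/colP => i; have := u0 i (mem_index_enum i).
by rewrite !mxE -expr2 sqrf_eq0 => /eqP.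
Qed.

(** Positivity of squares is what makes this hold: it fails over the complex
    numbers, where the row [(1, i)] has Gram matrix zero. *)
Lemma gram_mul_eq0 (R : realDomainType) m n (Y : 'M[R]_(m, n)) (v : 'cV_m) :
  Y *m Y^T *m v = 0 <-> Y^T *m v = 0.
Proof.
split=> [Uv|Yv]; last by rewrite -mulmxA Yv mulmx0.
by apply: sum_sqr_eq0; rewrite trmx_mul trmxK -mulmxA (mulmxA Y) Uv mulmx0.
Qed.

Lemma eq_gram_mul_D_of (R : realType) (V : vectType R)
    (br : {bilinear V -> V -> V}) (n : nat) (B : n.-tuple V)
    (v w : 'cV[R]_#|Lambda br B|) :
  gram_matrix br B *m v = gram_matrix br B *m w -> D_of v = D_of w.
Proof.
move=> Uvw; have /gram_mul_eq0/eqP : gram_matrix br B *m (v - w) = 0.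
  by rewrite mulmxBr Uvw subrr.
rewrite mulmxBr subr_eq0 => /eqP Yvw.
have Ric_vw : Ric_of v = Ric_of w by rewrite /Ric_of Yvw.
by rewrite /D_of /beta_of Ric_vw.
Qed.

Theorem theorem3p1 (R : realType) (V : vectType R)
    (br : {bilinear V -> V -> V}) (Q : {dot V for idfun})
    (n : nat) (B : n.-tuple V) :
  \dim {:V} = n ->
  lie_bracket br ->
  nilpotent br ->
  is_nilsoliton br Q ->
  ricci_eigenbasis br Q B ->
  gram_matrix br B \notin unitmx ->
  col_ker (root_matrix br B)^T = col_ker (gram_matrix br B) /\
  (forall v w : 'cV[R]_#|Lambda br B|,
     gram_matrix br B *m v = const_mx 1 ->
     gram_matrix br B *m w = const_mx 1 ->
     D_of v = D_of w).
Proof.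
move=> _ _ _ _ _ _; split=> [|v w Uv Uw].
  by apply/seteqP; split=> v /gram_mul_eq0.
by apply: eq_gram_mul_D_of; rewrite Uv Uw.
Qed.
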